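(* Let $\mathbf X\sim\mathrm E_n(\boldsymbol\mu,\Sigma,\tau)$ with $\Sigma$ invertible, let $\alpha\in(0,1/2)$, and let $\boldsymbol\sigma=(\sigma_1,\dots,\sigma_n)^\top$ with $\sigma_i=\sqrt{\sigma_{ii}}$. Then the maximization problem $\max_{\mathbf w\in\Delta_n}\mathbf w^\top\boldsymbol\sigma/\sqrt{\mathbf w^\top\Sigma\mathbf w}$ has a solution, and any maximizer $\mathbf w^*$ satisfies $$\mathrm{DQ}^{\rho}_\alpha(\mathbf w^*\odot\mathbf X)=\min_{\mathbf w\in\Delta_n}\mathrm{DQ}^{\rho}_\alpha(\mathbf w\odot\mathbf X)$$ for $\rho=\mathrm{VaR}$, and also for $\rho=\mathrm{ES}$ provided $Y\sim\mathrm E_1(0,1,\tau)$ satisfies $\mathbb E|Y|<\infty$.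
   Context: Let $(\Omega,\mathcal F,\mathbb P)$ be an atomless probability space. For $\alpha\in[0,1)$ and a random variable $X$, $\mathrm{VaR}_\alpha(X)=\inf\{x\in\mathbb R:\mathbb P(X\le x)\ge 1-\alpha\}$; for $\alpha\in(0,1)$ and integrable $X$, $\mathrm{ES}_\alpha(X)=\frac1\alpha\int_0^\alpha\mathrm{VaR}_\beta(X)\,\mathrm d\beta$. For $\rho\in\{\mathrm{VaR},\mathrm{ES}\}$, $\alpha\in(0,1)$ and $\mathbf X=(X_1,\dots,X_n)$ (integrable components when $\rho=\mathrm{ES}$), $\mathrm{DQ}^\rho_\alpha(\mathbf X)=\alpha^*/\alpha$, where $\alpha^*=\inf\{\beta\in(0,1):\rho_\beta(\sum_{i=1}^nX_i)\le\sum_{i=1}^n\rho_\alpha(X_i)\}$, with $\inf\emptyset=1$. A random vector $\mathbf X$ in $\mathbb R^n$ has elliptical distribution $\mathrm E_n(\boldsymbol\mu,\Sigma,\tau)$, with $\boldsymbol\mu\in\mathbb R^n$, $\Sigma=(\sigma_{ij})$ positive semi-definite and nonzero, and $\tau:[0,\infty)\to\mathbb R$, if $\mathbb E[\exp(\mathrm i\,\mathbf t^\top\mathbf X)]=\exp(\mathrm i\,\mathbf t^\top\boldsymbol\mu)\,\tau(\mathbf t^\top\Sigma\mathbf t)$ for all $\mathbf t\in\mathbb R^n$. $\Delta_n=\{\mathbf x\in[0,1]^n:x_1+\dots+x_n=1\}$, and for $\mathbf w\in\Delta_n$, $\mathbf w\odot\mathbf X=(w_1X_1,\dots,w_nX_n)$.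 *)

(* Defs.v *)
From HB Require Import structures.
From mathcomp Require Import all_boot all_order all_algebra.
From mathcomp Require Import all_classical all_reals all_analysis.
Set Implicit Arguments. Unset Strict Implicit. Unset Printing Implicit Defensive.
Import Order.TTheory GRing.Theory Num.Theory.
Import numFieldNormedType.Exports.
Local Open Scope classical_set_scope.
Local Open Scope ring_scope.

Section defs.
Context {d : measure_display} {T : measurableType d} {R : realType}.
Variable P : probability T R.

Definition atomless : Prop :=
  forall A : set T, measurable A -> (0 < P A)%E ->
    exists B : set T, [/\ measurable B, B `<=` A, (0 < P B)%E & (P B < P A)%E].

Definition cdf (X : T -> R) (x : R) : R := fine (P [set w | X w <= x]).

Definition VaR (a : R) (X : T -> R) : R := inf [set x : R | 1 - a <= cdf X x].

Definition ES (a : R) (X : T -> R) : R :=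
  a^-1 * Rintegral lebesgue_measure `]0, a[ (fun b => VaR b X).

Definition DQ (rho : R -> (T -> R) -> R) (n : nat) (a : R) (X : 'I_n -> T -> R) : R :=
  let S := [set b : R | (0 < b < 1) /\
             rho b (fun w => \sum_(i < n) X i w) <= \sum_(i < n) rho a (X i)] in
  (if pselect (S = set0) then 1 else inf S) / a.

Definition qform (n : nat) (S : 'M[R]_n) (t : 'I_n -> R) : R :=
  \sum_(i < n) \sum_(j < n) t i * S i j * t j.

(* X ~ E_n(mu, S, tau): E[exp(i t^T X)] = exp(i t^T mu) tau(t^T S t), written as
   real and imaginary parts; S symmetric positive semidefinite and nonzero. *)
Definition elliptical (n : nat) (X : 'I_n -> T -> R) (mu : 'I_n -> R)
    (S : 'M[R]_n) (tau : R -> R) : Prop :=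
  [/\ (forall i, measurable_fun setT (X i)),
      S^T = S, (forall t : 'I_n -> R, 0 <= qform S t), S != 0 &
      forall t : 'I_n -> R,
        (\int[P]_w (cos (\sum_(i < n) t i * X i w))%:E
           = (cos (\sum_(i < n) t i * mu i) * tau (qform S t))%:E)%E /\
        (\int[P]_w (sin (\sum_(i < n) t i * X i w))%:E
           = (sin (\sum_(i < n) t i * mu i) * tau (qform S t))%:E)%E].

End defs.

Definition simplex {R : realType} (n : nat) (w : 'I_n -> R) : Prop :=
  (forall i, 0 <= w i) /\ \sum_(i < n) w i = 1.

Definition wprod {T : Type} {R : realType} (n : nat) (w : 'I_n -> R) (X : 'I_n -> T -> R)
  : 'I_n -> T -> R := fun i x => w i * X i x.

Definition div_ratio {R : realType} (n : nat) (S : 'M[R]_n) (w : 'I_n -> R) : R :=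
  (\sum_(i < n) w i * Num.sqrt (S i i)) / Num.sqrt (qform S w).

(* Main.v *)
Require Import Defs.
From HB Require Import structures.
From mathcomp Require Import all_boot all_order all_algebra.
From mathcomp Require Import all_classical all_reals all_analysis.
From mathcomp Require Import measurable_realfun ring lra.
Set Implicit Arguments. Unset Strict Implicit. Unset Printing Implicit Defensive.
Import Order.TTheory GRing.Theory Num.Theory.
Import numFieldNormedType.Exports.
Local Open Scope classical_set_scope.
Local Open Scope ring_scope.

(* For every t with t^T S t > 0, the standardized combination
   Y = (t^T X - t^T mu) / sqrt (t^T S t) has the real characteristic function
   s |-> tau (s ^ 2), so its law is symmetric and does not depend on t.  Hence, for
   rho = VaR or ES, rho_b (t^T X) = t^T mu + sqrt (t^T S t) rho_b (Y), and
   DQ (w . X) is, up to the factor 1 / a, the infimum of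
   {b in (0, 1) | rho_b (Y) <= div_ratio S w * rho_a (Y)}.
   As a < 1/2, symmetry gives rho_a (Y) >= 0: the infimum decreases with the ratio.

   A law on the line is determined by its characteristic function because the
   indicator of a half-line is an iterated bounded pointwise limit of trigonometric
   polynomials: polynomials of sin ((z - c) / n) converge to sg (sin ((z - c) / n)),
   which converges to sg (z - c) as n grows, and one then lets c decrease to x. *)

(** * Characteristic functions determine laws *)

(** The phase [u] lets one constructor cover sines and constants, and closes the class under
    products by the product-to-sum formula. *)
Inductive trigpoly {R : realType} : (R -> R) -> Prop :=
| trigpoly_cos (c t u : R) : trigpoly (fun z => c * cos (t * z + u))
| trigpoly_add f g : trigpoly f -> trigpoly g -> trigpoly (fun z => f z + g z).

Section trigpoly_theory.
Context {R : realType}.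

Lemma measurable_cos : measurable_fun setT (@cos R).
Proof. by apply: continuous_measurable_fun; exact: continuous_cos. Qed.

Lemma measurable_sin : measurable_fun setT (@sin R).
Proof. by apply: continuous_measurable_fun; exact: continuous_sin. Qed.

Implicit Types f g : R -> R.

Lemma trigpolyM f g : trigpoly f -> trigpoly g -> trigpoly (fun z => f z * g z).
Proof.
elim=> {f} [c t u|f1 f2 _ IH1 _ IH2] tg; last first.
  rewrite (_ : (fun _ => _) = fun z => f1 z * g z + f2 z * g z).
    by apply: trigpoly_add; [exact: IH1|exact: IH2].
  by apply/funext => z; rewrite mulrDl.
elim: tg => {g} [c' t' u'|g1 g2 _ IH1 _ IH2]; last first.
  rewrite (_ : (fun _ => _) = fun z =>
      c * cos (t * z + u) * g1 z + c * cos (t * z + u) * g2 z).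
    exact: trigpoly_add.
  by apply/funext => z; rewrite mulrDr.
rewrite (_ : (fun _ => _) = fun z =>
    c * c' / 2 * cos ((t + t') * z + (u + u')) +
    c * c' / 2 * cos ((t - t') * z + (u - u'))).
  by apply: trigpoly_add; exact: trigpoly_cos.
apply/funext => z.
rewrite (_ : (t + t') * z + (u + u') = (t * z + u) + (t' * z + u')); last by ring.
rewrite (_ : (t - t') * z + (u - u') = (t * z + u) - (t' * z + u')); last by ring.
by move: (t * z + u) (t' * z + u') => A B; rewrite cosD cosB; field.
Qed.

Lemma trigpolyZ k f : trigpoly f -> trigpoly (fun z => k * f z).
Proof.
elim=> {f} [c t u|f1 f2 _ IH1 _ IH2].
  by under eq_fun do rewrite mulrA; exact: trigpoly_cos.
by under eq_fun do rewrite mulrDr; exact: trigpoly_add.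
Qed.

Lemma trigpoly_sin (t c : R) : trigpoly (fun z => sin (t * (z - c))).
Proof.
rewrite (_ : (fun _ => _) = fun z => 1 * cos (t * z + (- (t * c) - pi / 2))).
  exact: trigpoly_cos.
by apply/funext => z; rewrite mul1r addrA cosBpihalf mulrBr.
Qed.

Lemma trigpoly_measurable f : trigpoly f -> measurable_fun setT f.
Proof.
elim=> {f} [c t u|f g _ mf _ mg]; last exact: measurable_funD.
apply: measurable_funM => //; apply: (measurableT_comp (f := cos)).
  exact: measurable_cos.
by apply: measurable_funD => //; exact: measurable_funM.
Qed.

Lemma trigpoly_bounded f : trigpoly f -> exists M, forall z, `|f z| <= M.
Proof.
elim=> {f} [c t u|f g _ [M fM] _ [N gN]].
  by exists `|c| => z; rewrite normrM ler_piMr// cos_max.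
by exists (M + N) => z; rewrite (le_trans (ler_normD _ _))// lerD.
Qed.

(* The iterates of [y |-> (3 y - y ^+ 3) / 2] are polynomials that map [-1, 1]
   to itself and converge pointwise there to the sign function. *)
Definition sgpoly (y : R) : R := (3 * y - y ^+ 3) / 2.

Lemma sgpolyN y : sgpoly (- y) = - sgpoly y.
Proof. by rewrite /sgpoly; field. Qed.

(** For [x] in [0, 1], [sgpoly x - x = x * (1 - x ^+ 2) / 2 >= 0], and the gap to 1 is multiplied by
    [(1 - x) * (2 + x) / 2 <= 1 - x / 2]. Iterates stay above [y], so this factor is at most
    [1 - y / 2] at every step. *)
Lemma sgpoly_iter_itv n (y : R) : 0 <= y <= 1 ->
  y <= iter n sgpoly y <= 1 /\ 1 - iter n sgpoly y <= (1 - y / 2) ^+ n.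
Proof.
move=> /andP[y0 y1]; elim: n => [|n [/andP[yn n1] IH]] /=.
  by rewrite expr0 lexx y1; split=> //; lra.
set x := iter n _ _ in yn n1 IH *.
have x0 : 0 <= x by exact: le_trans yn.
split; rewrite /sgpoly.
  apply/andP; split.
    apply: (le_trans yn); have : 0 <= x * (1 - x ^+ 2).
      by rewrite mulr_ge0// subr_ge0 expr_le1.
    by rewrite mulrBr mulr1 -exprS; lra.
  have : 0 <= (1 - x) ^+ 2 * (2 + x) by rewrite mulr_ge0 ?sqr_ge0//; lra.
  by rewrite (_ : _ * _ = 2 - 3 * x + x ^+ 3); [lra|ring].
rewrite [leRHS]exprS.
have -> : 1 - (3 * x - x ^+ 3) / 2 = ((1 - x) * (2 + x) / 2) * (1 - x) by field.
apply: ler_pM => //; [|lra|].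
  by rewrite divr_ge0// mulr_ge0//; lra.
rewrite (_ : (1 - x) * (2 + x) / 2 = 1 - x / 2 - x ^+ 2 / 2); last by field.
have : 0 <= x ^+ 2 by exact: sqr_ge0.
by lra.
Qed.

Lemma sgpoly_iterN n y : iter n sgpoly (- y) = - iter n sgpoly y.
Proof. by elim: n => //= n ->; rewrite sgpolyN. Qed.

Lemma sgpoly_iter_norm n (y : R) : `|y| <= 1 -> `|iter n sgpoly y| <= 1.
Proof.
wlog y0 : y / 0 <= y => [H|].
  have [|y0] := leP 0 y; first exact: H.
  by rewrite -normrN -[`|iter _ _ _|]normrN -sgpoly_iterN; apply: H; lra.
rewrite ger0_norm// => y1.
have [|/andP[yn n1] _] := @sgpoly_iter_itv n y; first by rewrite y0.
by rewrite ger0_norm// (le_trans y0).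
Qed.

Lemma sgpoly_iter_cvg (y : R) : `|y| <= 1 ->
  (fun n => iter n sgpoly y) @ \oo --> Num.sg y.
Proof.
wlog y0 : y / 0 <= y => [H|].
  have [|y0] := leP 0 y; first exact: H.
  move=> y1; rewrite -[Num.sg y]opprK -sgrN.
  rewrite (_ : (fun _ => _) = \- (fun n => iter n sgpoly (- y))).
    by apply: cvgN; apply: H; rewrite ?normrN// oppr_ge0 ltW.
  by apply/funext => n /=; rewrite sgpoly_iterN opprK.
rewrite ger0_norm// => y1; have [y00|yN0] := eqVneq y 0.
  rewrite y00 sgr0; apply: cvg_near_cst; near=> n.
  by elim: (n) => //= m ->; rewrite /sgpoly; field.
have yp : 0 < y by rewrite lt0r yN0.
rewrite gtr0_sg//.
apply: (@squeeze_cvgr _ _ _ _ (fun n => 1 - (1 - y / 2) ^+ n) (fun=> 1)).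
- near=> n; have [|/andP[_ ->] ] := @sgpoly_iter_itv n y; first by rewrite y0.
  by rewrite andbT lerBlDr -lerBlDl.
- rewrite -[X in _ --> X]subr0; apply: cvgB; first exact: cvg_cst.
  by apply: cvg_expr; rewrite ger0_norm; lra.
- exact: cvg_cst.
Unshelve. all: by end_near. Qed.

Lemma trigpoly_sgpoly n f : trigpoly f -> trigpoly (fun z => iter n sgpoly (f z)).
Proof.
move=> tf; elim: n => //= n IH.
rewrite (_ : (fun _ => _) = fun z => 3 / 2 * iter n sgpoly (f z) +
   (- 2^-1) * (iter n sgpoly (f z) * (iter n sgpoly (f z) * iter n sgpoly (f z)))).
  by apply: trigpoly_add; apply: trigpolyZ => //; do 2 apply: trigpolyM => //.
by apply/funext => z; rewrite /sgpoly; field.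
Qed.

(** The sine is positive on ]0, 1[, which lies inside ]0, pi[; oddness gives the negative side. *)
Lemma sg_sin (u : R) : `|u| < 1 -> Num.sg (sin u) = Num.sg u.
Proof.
wlog u0 : u / 0 < u => [H|].
  have [|u0|u0] := ltgtP 0 u; [exact: H| |by rewrite -u0 sin0].
  by rewrite -normrN -[u in RHS]opprK sgrN => u1;
    rewrite -[Num.sg (- u)]H ?oppr_gt0// sinN sgrN opprK.
rewrite gtr0_norm// => u1; rewrite !gtr0_sg// sin_gt0_pi// u0 (lt_trans u1)//.
by have := @pi_ge2 R; lra.
Qed.

End trigpoly_theory.

Lemma measurable_sublevel d (T : measurableType d) (R : realType) (X : T -> R) x :
  measurable_fun setT X -> measurable [set w | X w <= x].
Proof.
by move=> mX; rewrite -[X in measurable X]setTI; exact: measurable_fun_le.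
Qed.

(** * Equality in law from equal cosine and sine means *)

Section cos_sin_mean.
Context d1 d2 (T1 : measurableType d1) (T2 : measurableType d2) (R : realType).
Variables (P1 : probability T1 R) (P2 : probability T2 R).
Variables (X1 : T1 -> R) (X2 : T2 -> R).
Hypotheses (mX1 : measurable_fun setT X1) (mX2 : measurable_fun setT X2).

Definition same_mean (f : R -> R) :=
  (\int[P1]_w (f (X1 w))%:E = \int[P2]_w (f (X2 w))%:E)%E.

Lemma bounded_comp_integrable d (T : measurableType d) (P : probability T R)
    (X : T -> R) (f : R -> R) M :
  measurable_fun setT X -> measurable_fun setT f -> (forall z, `|f z| <= M) ->
  P.-integrable setT (EFin \o (f \o X)).
Proof.
move=> mX mf fM; apply: (@le_integrable _ _ _ P _ measurableT _ (cst M%:E)).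
- by apply/measurable_EFinP; exact: measurableT_comp.
- by move=> w _ /=; rewrite lee_fin (le_trans (fM _))// ler_norm.
- by apply: finite_measure_integrable_cst.
Qed.

(** Dominated convergence on each space, with the constant 1 as dominating function. *)
Lemma same_mean_lim (f_ : nat -> R -> R) (f : R -> R) :
  (forall n, measurable_fun setT (f_ n)) -> (forall n z, `|f_ n z| <= 1) ->
  (forall z, f_ ^~ z @ \oo --> f z) -> (forall n, same_mean (f_ n)) ->
  same_mean f.
Proof.
move=> mf_ f1 f_f fE.
have mf : measurable_fun setT f by apply: (measurable_fun_cvg mf_) => z _; exact: f_f.
have cvgE d (T : measurableType d) (P : probability T R) (X : T -> R) :
    measurable_fun setT X ->
    (\int[P]_w (f_ n (X w))%:E @[n --> \oo] --> \int[P]_w (f (X w))%:E)%E.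
  move=> mX; have [] := @dominated_convergence _ _ _ P _ measurableT
    (fun n => EFin \o (f_ n \o X)) (EFin \o (f \o X)) (cst 1%E).
  - by move=> n; apply/measurable_EFinP; exact: measurableT_comp.
  - by apply/measurable_EFinP; exact: measurableT_comp.
  - by apply: aeW => w _; apply/fine_cvgP; split; [exact: nearW|exact: f_f].
  - exact: finite_measure_integrable_cst.
  - by apply: aeW => w n _; rewrite /= lee_fin.
  by [].
(* By [fE] the two sequences of means coincide, hence so do their limits. *)
have := cvgE _ _ P1 _ mX1; rewrite (funext fE) => /cvg_unique; apply.
  exact: ereal_hausdorff.
exact: cvgE.
Qed.

Hypothesis cosE : forall t, same_mean (fun z => cos (t * z)).
Hypothesis sinE : forall t, same_mean (fun z => sin (t * z)).

Lemma same_mean_trigpoly f : trigpoly f -> same_mean f.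
Proof.
elim=> {f} [c t u|f g tf fE tg gE]; last first.
  have [M fM] := trigpoly_bounded tf; have [N gN] := trigpoly_bounded tg.
  have mf := trigpoly_measurable tf; have mg := trigpoly_measurable tg.
  have split d (T : measurableType d) (P : probability T R) (X : T -> R) :
      measurable_fun setT X ->
      (\int[P]_w (f (X w) + g (X w))%:E =
       \int[P]_w (f (X w))%:E + \int[P]_w (g (X w))%:E)%E.
    move=> mX; under eq_integral do rewrite EFinD.
    by rewrite integralD//; [exact: (bounded_comp_integrable _ mX mf fM)|
      exact: (bounded_comp_integrable _ mX mg gN)].
  by rewrite /same_mean !split// fE gE.
have mcos (s : R) : measurable_fun setT (fun z : R => cos (s * z)).
  apply: (measurableT_comp (f := cos)); last exact: measurable_funM.
  exact: measurable_cos.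
have msin (s : R) : measurable_fun setT (fun z : R => sin (s * z)).
  apply: (measurableT_comp (f := sin)); last exact: measurable_funM.
  exact: measurable_sin.
(* The addition formula for [cos (t * z + u)] leaves only the means that [cosE] and [sinE]
   control. *)
have split d (T : measurableType d) (P : probability T R) (X : T -> R) :
    measurable_fun setT X ->
    (\int[P]_w (c * cos (t * X w + u))%:E =
     (c * cos u)%:E * \int[P]_w (cos (t * X w))%:E +
     (- (c * sin u))%:E * \int[P]_w (sin (t * X w))%:E)%E.
  move=> mX.
  have Ic : P.-integrable setT (fun w => (cos (t * X w))%:E).
    by apply: (@bounded_comp_integrable _ _ _ X (fun z => cos (t * z)) 1) => // z;
      exact: cos_max.
  have Is : P.-integrable setT (fun w => (sin (t * X w))%:E).
    by apply: (@bounded_comp_integrable _ _ _ X (fun z => sin (t * z)) 1) => // z;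
      exact: sin_max.
  rewrite -integralZl// -integralZl// -integralD//; try exact: integrableZl.
  apply: eq_integral => w _; rewrite -!EFinM -EFinD cosD; congr EFin; ring.
by rewrite /same_mean !split//; congr (_ * _ + _ * _)%E; [exact: cosE|exact: sinE].
Qed.

Lemma same_mean_sg c : same_mean (fun z => Num.sg (z - c)).
Proof.
pose s (n : nat) z : R := Num.sg (sin (n.+1%:R^-1 * (z - c))).
have smE n : measurable_fun setT (s n) /\ same_mean (s n).
  pose p k z := iter k sgpoly (sin (n.+1%:R^-1 * (z - c))).
  have tp k : trigpoly (p k) by apply: trigpoly_sgpoly; exact: trigpoly_sin.
  have pcvg z : p ^~ z @ \oo --> s n z by apply: sgpoly_iter_cvg; exact: sin_max.
  split.
    by apply: (measurable_fun_cvg (fun k => trigpoly_measurable (tp k))) => z _.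
  apply: (@same_mean_lim p) => //.
  - by move=> k; exact: trigpoly_measurable.
  - by move=> k z; apply: sgpoly_iter_norm; exact: sin_max.
  - by move=> k; exact: same_mean_trigpoly.
apply: (@same_mean_lim s) => [n|n z|z|n]; [exact: (smE n).1| | |exact: (smE n).2].
  by rewrite normr_sg lern1 leq_b1.
(* Once [n] exceeds [|z - c|], the argument of the sine lies in ]-1, 1[ and [sg_sin] applies: the
   sequence is eventually constant. *)
apply: cvg_near_cst; near=> n.
rewrite /s sg_sin; first by rewrite sgrM [Num.sg _^-1]gtr0_sg ?invr_gt0// mul1r.
rewrite normrM gtr0_norm ?invr_gt0// mulrC ltr_pdivrMr// mul1r.
near: n; apply: filterS (nbhs_infty_gtr `|z - c|) => n /lt_trans; apply.
by rewrite ltr_nat.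
Unshelve. all: by end_near. Qed.

Lemma cos_sin_mean_inj x : P1 [set w | X1 w <= x] = P2 [set w | X2 w <= x].
Proof.
(* [g] is 1 minus twice the indicator of the closed half-line up to [x]. The centres
   [x + n.+1%:R^-1] below stay strictly above [x], so that the point [z = x] receives the sign
   -1. *)
pose g z : R := if z <= x then -1 else 1.
have gE : same_mean g.
  apply: (@same_mean_lim (fun n z => Num.sg (z - (x + n.+1%:R^-1)))).
  - have msg : measurable_fun setT (Num.sg : R -> R).
      apply: nondecreasing_measurable => // u v uv.
      by case: (sgrP v); case: (sgrP u) => //; lra.
    by move=> n; apply: (measurableT_comp msg); exact: measurable_funB.
  - by move=> n z; rewrite normr_sg lern1 leq_b1.
  - move=> z; rewrite /g; have [zx|] := leP z x.
      apply: cvg_near_cst; near=> n.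
      by rewrite ltr0_sg// subr_lt0 (le_lt_trans zx)// ltrDl invr_gt0.
    rewrite -subr_gt0 => zx; apply: cvg_near_cst; near=> n.
    rewrite gtr0_sg// subr_gt0 -ltrBrDl.
    near: n; exact: (near_infty_natSinv_lt (PosNum zx)).
  - by move=> n; exact: same_mean_sg.
have EE d (T : measurableType d) (P : probability T R) (X : T -> R) :
    measurable_fun setT X ->
    (\int[P]_w (g (X w))%:E = 1 - 2%:E * P [set w | X w <= x]%R)%E.
  move=> mX; have mA := measurable_sublevel x mX.
  have -> : P [set w | X w <= x]%R =
      (\int[P]_w (\1_[set w | X w <= x]%R w)%:E)%E by rewrite integral_indic// setIT.
  have <- : (\int[P]_w (cst 1%:E) w = 1)%E.
    by rewrite integral_cst//= mul1e probability_setT.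
  rewrite -integralZl//; last exact: integrable_indic.
  rewrite -integralB//.
  - apply: eq_integral => w _; rewrite /g indicE /=.
    case: ifPn => Xx; [rewrite mem_set//|rewrite memNset//; last exact/negP].
      by rewrite mulr1 -EFinD; congr EFin; lra.
    by rewrite mulr0 oppr0 adde0.
  - exact: finite_measure_integrable_cst.
  - by apply: integrableZl => //; exact: integrable_indic.
have fin d (T : measurableType d) (P : probability T R) (X : T -> R) :
    measurable_fun setT X -> P [set w | X w <= x] \is a fin_num.
  by move=> mX; rewrite fin_num_measure//; exact: measurable_sublevel.
move: gE; rewrite /same_mean !EE// -(fineK (fin _ _ P1 _ mX1)).
rewrite -(fineK (fin _ _ P2 _ mX2)) -!EFinM -!EFinB => -[] H.
by congr EFin; lra.
Unshelve. all: by end_near. Qed.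

End cos_sin_mean.

(** * Value-at-Risk and Expected Shortfall *)

(** Monotonicity makes the preimage in [D] of each ray [[r, +oo[] an interval. *)
Lemma nonincreasing_interval_measurable {R : realType} (D : set R) (f : R -> R) :
  is_interval D -> {in D &, {homo f : x y /~ x <= y}} -> measurable_fun D f.
Proof.
move=> iD fni mD.
apply: (measurability (@RGenCInfty.G R)) => //.
  exact: RGenCInfty.measurableE.
move=> _ [_] [r] -> <-; apply: is_interval_measurable => s t /=.
rewrite !in_itv/= !andbT => -[Ds fs] [Dt ft] u sut.
have Du : D u by exact: iD sut.
split => //; rewrite in_itv/= andbT (le_trans ft)// fni ?inE//.
by case/andP: sut.
Qed.

(* [Defs.cdf] is real-valued; unqualified, [cdf] is the extended-real library one. *)
Section VaR_ES.
Context d (T : measurableType d) (R : realType) (P : probability T R).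

Lemma cdfEFin (X : T -> R) (mX : measurable_fun setT X) x :
  (Defs.cdf P X x)%:E = P [set w | X w <= x].
Proof. by rewrite /Defs.cdf fineK// fin_num_measure//; exact: measurable_sublevel. Qed.

Lemma cdf_nd (X : T -> R) (mX : measurable_fun setT X) x y :
  x <= y -> Defs.cdf P X x <= Defs.cdf P X y.
Proof.
move=> xy; rewrite -lee_fin !cdfEFin// le_measure ?inE//.
- exact: measurable_sublevel.
- exact: measurable_sublevel.
- by move=> w /= /le_trans; apply.
Qed.

(** This and [cdf_near0] ensure that for [0 < b < 1] the infimum defining VaR is a true one, not a
    default value: its set is nonempty and bounded below. *)
Lemma cdf_near1 (X : T -> R) (mX : measurable_fun setT X) b :
  0 < b -> exists x, 1 - b <= Defs.cdf P X x.
Proof.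
move=> b0; pose Y : {RV P >-> R} := HB.pack X (isMeasurableFun.Build _ _ _ _ X mX).
have /fine_cvgP[_ /cvgrPdist_le /(_ _ b0)] := cvg_cdfy1 Y.
move=> [M [_ MP]]; exists (M + 1); have := MP (M + 1).
rewrite ltrDl ltr01 => /(_ isT) /=.
rewrite (_ : fine _ = Defs.cdf P X (M + 1)).
  by move=> /(le_trans (ler_norm _)); lra.
rewrite /Defs.cdf; congr (fine (P _)); apply/seteqP; split => w /=;
  by rewrite in_itv.
Qed.

Lemma cdf_near0 (X : T -> R) (mX : measurable_fun setT X) b :
  b < 1 -> exists x0, forall x, 1 - b <= Defs.cdf P X x -> x0 <= x.
Proof.
move=> b1; pose Y : {RV P >-> R} := HB.pack X (isMeasurableFun.Build _ _ _ _ X mX).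
(* With this tolerance the cdf at [M - 1] is at most [(1 - b) / 2], strictly below [1 - b]. *)
have b0 : 0 < (1 - b) / 2 by lra.
have /fine_cvgP[_ /cvgrPdist_le /(_ _ b0)] := cvg_cdfNy0 Y.
move=> [M [_ MP]]; exists (M - 1) => x xb; rewrite leNgt; apply/negP => xM.
have := MP (M - 1); rewrite gtrDl ltrN10 => /(_ isT) /=.
rewrite (_ : fine _ = Defs.cdf P X (M - 1)).
  rewrite sub0r normrN => /(le_trans (ler_norm _)).
  have := cdf_nd mX (ltW xM); lra.
rewrite /Defs.cdf; congr (fine (P _)); apply/seteqP; split => w /=;
  by rewrite in_itv.
Qed.

Lemma VaR_le (X : T -> R) (mX : measurable_fun setT X) b x :
  b < 1 -> 1 - b <= Defs.cdf P X x -> VaR P b X <= x.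
Proof.
move=> b1 bx; have [x0 x0P] := cdf_near0 mX b1.
by apply: inf_lbound => //; exists x0 => y /x0P.
Qed.

Lemma VaR_ge (X : T -> R) (mX : measurable_fun setT X) b y :
  0 < b -> (forall x, 1 - b <= Defs.cdf P X x -> y <= x) -> y <= VaR P b X.
Proof.
move=> b0 yP; have [x1 x1P] := cdf_near1 mX b0.
by apply: lb_le_inf; [exists x1|move=> x /yP].
Qed.

Lemma VaR_ni (X : T -> R) (mX : measurable_fun setT X) b c :
  0 < b -> c < 1 -> b <= c -> VaR P c X <= VaR P b X.
Proof.
move=> b0 c1 bc; apply: VaR_ge => // x bx.
by apply: VaR_le => //; apply: le_trans bx; lra.
Qed.

(** The set defining VaR of [X] is the image of that of [Y] under [y |-> m + q * y]. Only the cdfs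
    are related, so that an affine relation in law suffices. *)
Lemma VaR_affine (X Y : T -> R) m q b :
  measurable_fun setT X -> measurable_fun setT Y -> 0 < q ->
  (forall x, Defs.cdf P X x = Defs.cdf P Y ((x - m) / q)) -> 0 < b < 1 ->
  VaR P b X = m + q * VaR P b Y.
Proof.
move=> mX mY q0 XY /andP[b0 b1]; apply/eqP; rewrite eq_le; apply/andP; split.
  rewrite -lerBlDl mulrC -ler_pdivrMr//; apply: VaR_ge => // x bx.
  rewrite ler_pdivrMr// lerBlDl; apply: VaR_le => //.
  by rewrite XY addrAC subrr add0r mulfK// gt_eqF.
apply: VaR_ge => // x; rewrite XY => bx.
by rewrite -lerBrDl mulrC -ler_pdivlMr//; exact: VaR_le.
Qed.

(** Serves the components of zero weight, which the condition [0 < q] of [VaR_affine] excludes. *)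
Lemma VaR0 b : 0 < b < 1 -> VaR P b (fun=> 0) = 0.
Proof.
move=> /andP[b0 b1]; have m0 : measurable_fun setT (fun _ : T => 0 : R) by [].
apply/eqP; rewrite eq_le; apply/andP; split.
  apply: VaR_le => //; rewrite /Defs.cdf (_ : [set _ | _] = setT).
    by rewrite probability_setT /=; lra.
  by apply/seteqP; split => w //= _.
apply: VaR_ge => // x bx; rewrite leNgt; apply/negP => x0; move: bx.
rewrite /Defs.cdf (_ : [set _ | _] = set0); first by rewrite measure0 /=; lra.
by apply/seteqP; split => w //=; lra.
Qed.

(** For [x < 0] the events [Y <= x] and [- Y <= x] are disjoint and, by symmetry, equally likely;
    the cdf at [x] is thus at most 1/2, below [1 - b]. *)
Lemma VaR_sym_ge0 (Y : T -> R) b : measurable_fun setT Y ->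
  (forall x, Defs.cdf P (\- Y) x = Defs.cdf P Y x) -> 0 < b < 1 / 2 ->
  0 <= VaR P b Y.
Proof.
move=> mY symY /andP[b0 b12]; apply: VaR_ge => // x bx.
rewrite leNgt; apply/negP => x0; move: bx; apply/negP; rewrite -ltNge.
have mN : measurable_fun setT (\- Y) by exact: measurable_funN.
suff : Defs.cdf P Y x + Defs.cdf P (\- Y) x <= 1 by rewrite symY; lra.
rewrite -lee_fin EFinD !cdfEFin// -measureU//.
- by apply: probability_le1; apply: measurableU; exact: measurable_sublevel.
- exact: measurable_sublevel.
- exact: measurable_sublevel.
- by apply/seteqP; split => w //= [+ +]; lra.
Qed.

Lemma VaR_measurable (Y : T -> R) : measurable_fun setT Y ->
  measurable_fun (`]0, 1[ : set R) (fun b : R => VaR P b Y).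
Proof.
move=> mY; apply: nonincreasing_interval_measurable => [|b c].
  exact: interval_is_interval.
rewrite !inE /= !in_itv /= => /andP[b0 b1] /andP[c0 c1] bc.
exact: VaR_ni.
Qed.

(* For r >= 0, VaR_b (Y) > r forces b < P (Y > r): on (0, 1) with the uniform law,
   the tail of the positive part of VaR is dominated by that of Y. *)
Lemma VaR_integrable (Y : T -> R) b : measurable_fun setT Y ->
  P.-integrable setT (EFin \o Y) -> 0 < b < 1 ->
  lebesgue_measure.-integrable `]0, b[ (EFin \o (fun b => VaR P b Y)).
Proof.
move=> mY iY /andP[b0 b1].
(* Positive part of VaR, extended by 0 outside ]0, 1[ so as to be a random variable under the
   uniform law. *)
pose q : R -> R := (fun b : R => Num.max (VaR P b Y) 0) \_ `]0, 1[.
have mq : measurable_fun setT q.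
  apply/(measurable_restrictT _ _).1 => //.
  by apply: measurable_maxr => //; exact: VaR_measurable.
have q0 x : 0 <= q x by rewrite /q patchE; case: ifPn => // _; rewrite le_max lexx orbT.
pose U := uniform_prob (@ltr01 R).
pose Q : {RV U >-> R} := HB.pack q
  (isMeasurableFun.Build _ _ (measurableTypeR R) _ q mq).
have mY' : measurable_fun setT (Y^\+)%R by exact: measurable_funrpos.
pose Y' : {RV P >-> R} := HB.pack (Y^\+)%R (isMeasurableFun.Build _ _ _ _ _ mY').
have ccdfQ r : 0 <= r -> (ccdf Q r <= ccdf Y' r)%E.
  move=> r0; rewrite /ccdf /distribution /pushforward /=.
  have p0 : 0 <= 1 - Defs.cdf P Y r.
    rewrite subr_ge0 -lee_fin cdfEFin//; apply: probability_le1.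
    exact: measurable_sublevel.
  apply: (@le_trans _ _ (1 - Defs.cdf P Y r)%:E); last first.
    rewrite EFinB cdfEFin// -probability_setC; last exact: measurable_sublevel.
    rewrite le_measure ?inE//.
    - by apply: measurableC; exact: measurable_sublevel.
    - by rewrite -[X in measurable X]setTI; exact: (mY').
    - move=> w /= /negP; rewrite -ltNge in_itv /= andbT => rw.
      by rewrite /funrpos lt_max rw.
  apply: (@le_trans _ _ (U `]0, (1 - Defs.cdf P Y r)[%classic)).
    apply: le_measure; rewrite ?inE//.
    - by rewrite -[X in measurable X]setTI; exact: (mq).
    - move=> x /=; rewrite !in_itv /= andbT /q patchE; case: ifPn => [|_]; last first.
        by move=> /(le_lt_trans r0); rewrite ltxx.
      rewrite inE /= in_itv /= => /andP[x0 x1]; rewrite lt_max => /orP[|]; last lra.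
      rewrite x0 /= => rx; rewrite ltNge; apply/negP => xr; move: rx; apply/negP.
      by rewrite -leNgt; apply: VaR_le => //; lra.
  apply: (@le_trans _ _
      (\int[lebesgue_measure]_(x in `]0%R, (1 - Defs.cdf P Y r)%R[) 1)%E).
    apply: ge0_le_integral => //.
    - by move=> x _; rewrite lee_fin; exact: uniform_pdf_ge0.
    - by apply/measurable_EFinP/measurable_funTS; exact: measurable_uniform_pdf.
    - by move=> x _; rewrite lee_fin /uniform_pdf; case: ifPn; rewrite // subr0 invr1.
  rewrite integral_cst//= mul1e lebesgue_measure_itv /= lte_fin.
  by case: ifPn; rewrite // sube0.
(* The mean of [q] is the integral of its tail [ccdf Q], at most that of [ccdf Y'], which is the
   finite mean of the positive part of [Y]. *)
have iq : (\int[lebesgue_measure]_(x in `[0%R, 1%R]) (q x)%:E < +oo)%E.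
  have := @integral_uniform R 0 1 ltr01 (EFin \o q).
  rewrite subr0 invr1 mul1e => <-; last 2 first.
  - exact/measurable_EFinP.
  - by move=> x; rewrite /= lee_fin.
  have := @ge0_expectation_ccdf _ _ _ _ Q q0; rewrite unlock => ->.
  apply: (@le_lt_trans _ _ (expectation P Y')).
    rewrite ge0_expectation_ccdf; last by move=> w; exact: funrpos_ge0.
    apply: ge0_le_integral => //.
    - by apply: measurable_funTS; exact: ccdf_measurable.
    - by apply: measurable_funTS; exact: ccdf_measurable.
    - by move=> r; rewrite /= in_itv /= andbT => /ccdfQ.
  rewrite unlock; apply: integrable_lty => //.
  exact: integrable_funrpos.
have sub : (`]0, b[ : set R) `<=` `[0, 1].
  by move=> x /=; rewrite !in_itv /= => /andP[? ?]; apply/andP; split; lra.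
have sub' : (`]0, b[ : set R) `<=` `]0, 1[.
  by move=> x /=; rewrite !in_itv /= => /andP[? ?]; apply/andP; split; lra.
(* On ]0, b[ VaR is at least [VaR P b Y], so the constant controls the negative part while [q]
   controls the positive one. *)
apply: (@le_integrable _ (measurableTypeR R) _ lebesgue_measure _
  (measurable_itv _) _ (fun x : R => (q x)%:E + (`|VaR P b Y|)%:E)%E) => //.
- by apply/measurable_EFinP; apply: measurable_funS (VaR_measurable mY).
- move=> x; rewrite /= in_itv /= => /andP[x0 xb].
  have x1 : x < 1 by exact: lt_trans b1.
  rewrite lee_fin [leRHS]ger0_norm; last by rewrite addr_ge0.
  rewrite /q patchE mem_set/= ?in_itv/= ?x0//.
  have := VaR_ni mY x0 b1 (ltW xb).
  move: (VaR P x Y) (VaR P b Y) => u v vu.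
  have : u <= Num.max u 0 by rewrite le_max lexx.
  have : 0 <= Num.max u 0 by rewrite le_max lexx orbT.
  have := ler_norm v; have := ler_norm (- v); rewrite normrN ler_norml.
  by move=> *; apply/andP; split; lra.
- apply: integrableD => //.
    apply: (@integrableS _ (measurableTypeR R) _ lebesgue_measure
      `[0, 1]%classic) => //.
    apply/integrableP; split; first by apply/measurable_EFinP/measurable_funTS.
    by under eq_integral do rewrite /= ger0_norm//.
  apply/integrableP; split; first exact: measurable_cst.
  rewrite integral_cst//= lebesgue_measure_itv /= lte_fin b0 sube0.
  by rewrite -EFinM ltry.
Qed.

(** [VaR_affine] is averaged over ]0, b[; integrability of VaR of [Y] lets the integral split. *)
Lemma ES_affine (X Y : T -> R) m q b :
  measurable_fun setT X -> measurable_fun setT Y -> 0 < q ->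
  (forall x, Defs.cdf P X x = Defs.cdf P Y ((x - m) / q)) ->
  P.-integrable setT (EFin \o Y) -> 0 < b < 1 ->
  ES P b X = m + q * ES P b Y.
Proof.
move=> mX mY q0 XY iY b01; have /andP[b0 b1] := b01; rewrite /ES.
have iV := VaR_integrable mY iY b01.
have -> : Rintegral lebesgue_measure `]0, b[ (fun b => VaR P b X) =
          Rintegral lebesgue_measure `]0, b[ (fun b => m + q * VaR P b Y).
  apply: eq_Rintegral => x; rewrite inE /= in_itv /= => /andP[x0 xb].
  by apply: VaR_affine => //; rewrite x0 (lt_trans xb).
rewrite RintegralD//; last 2 first.
- apply/integrableP; split; first exact: measurable_cst.
  rewrite integral_cst//= lebesgue_measure_itv /= lte_fin b0 sube0.
  by rewrite -EFinM ltry.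
- exact: (integrableZl _ q iV).
rewrite RintegralZl// Rintegral_cst//=.
rewrite lebesgue_measure_itv /= lte_fin b0 sube0 /=.
by field; rewrite gt_eqF.
Qed.

Lemma ES0 b : 0 < b < 1 -> ES P b (fun=> 0) = 0.
Proof.
move=> /andP[b0 b1]; rewrite /ES (@eq_Rintegral _ _ _ _ _ (fun=> 0)).
  by rewrite Rintegral_cst//= mul0r mulr0.
move=> x; rewrite inE /= in_itv /= => /andP[x0 xb].
by rewrite VaR0// x0 (lt_trans xb).
Qed.

Lemma ES_sym_ge0 (Y : T -> R) b : measurable_fun setT Y ->
  (forall x, Defs.cdf P (\- Y) x = Defs.cdf P Y x) -> 0 < b < 1 / 2 ->
  0 <= ES P b Y.
Proof.
move=> mY symY /andP[b0 b1]; rewrite mulr_ge0 ?invr_ge0 ?(ltW b0)//.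
apply: Rintegral_ge0 => x; rewrite /= in_itv /= => /andP[x0 xb].
by apply: VaR_sym_ge0 => //; rewrite x0 (lt_trans xb).
Qed.

End VaR_ES.

(** * The diversification ratio on the simplex *)

Section quadratic_form.
Context {R : realType} (n : nat) (S : 'M[R]_n).
Hypotheses (S_sym : S^T = S) (S_psd : forall t : 'I_n -> R, 0 <= qform S t).
Hypothesis S_unit : S \in unitmx.

Lemma qformE (u : 'rV[R]_n) : qform S (u ord0) = (u *m S *m u^T) ord0 ord0.
Proof.
rewrite mxE /qform exchange_big /=; apply: eq_bigr => j _.
by rewrite !mxE mulr_suml; apply: eq_bigr => i _.
Qed.

(* If q (u) = 0 then, for v = u S, q (u + c v) = 2 c |v|^2 + c^2 q (v) >= 0 for all c,
   which forces v = 0. *)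
Lemma qform_def (t : 'I_n -> R) i : t i != 0 -> 0 < qform S t.
Proof.
move=> ti0; rewrite lt0r S_psd andbT; apply: contraNneq ti0 => q0.
pose u := \row_j t j; pose v := u *m S.
have psd (w : 'rV[R]_n) : 0 <= (w *m S *m w^T) ord0 ord0.
  by rewrite -qformE; exact: S_psd.
have uE : (u *m S *m u^T) ord0 ord0 = 0.
  rewrite -qformE -[RHS]q0; congr (qform S _).
  by apply/funext => j; rewrite mxE.
set s := (v *m v^T) ord0 ord0; set p := (v *m S *m v^T) ord0 ord0.
have quad c : 0 <= 2 * c * s + c ^+ 2 * p.
  suff -> : 2 * c * s + c ^+ 2 * p =
      ((u + c *: v) *m S *m (u + c *: v)^T) ord0 ord0 by exact: psd.
  have vu : v *m S *m u^T = v *m v^T.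
    by rewrite -mulmxA /v trmx_mul S_sym.
  rewrite linearD /= linearZ /= !mulmxDl !mulmxDr -!scalemxAl -!scalemxAr.
  have addE (A B : 'M[R]_1) : (A + B) ord0 ord0 = A ord0 ord0 + B ord0 ord0.
    by rewrite mxE.
  have scaleE c' (A : 'M[R]_1) : (c' *: A) ord0 ord0 = c' * A ord0 ord0.
    by rewrite mxE.
  rewrite -/v vu !(addE, scaleE) uE -/s -/p; ring.
have p0 : 0 <= p by exact: psd.
have s0 : s = 0.
  (* For [p > 0] the minimizer is [- s / p]; using [p + 1] avoids dividing by a vanishing [p] and
     still gives a negative value unless [s = 0]. *)
  have := quad (- s / (p + 1)).
  rewrite (_ : _ + _ = - (s ^+ 2 * (p + 2)) / (p + 1) ^+ 2); last first.
    by field; rewrite gt_eqF//; lra.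
  rewrite pmulr_lge0; last by rewrite invr_gt0 exprn_gt0//; lra.
  rewrite oppr_ge0 pmulr_lle0; last by lra.
  by move=> s2; apply/eqP; rewrite -[_ == _]sqrf_eq0 eq_le s2 sqr_ge0.
have v0 : v = 0.
  apply/rowP => j; rewrite [RHS]mxE; apply/eqP; rewrite -sqrf_eq0.
  move: s0; rewrite /s mxE => /eqP; rewrite psumr_eq0.
    by move=> /allP /(_ j); rewrite mem_index_enum [v^T _ _]mxE => /(_ isT).
  by move=> k _; rewrite [v^T _ _]mxE -expr2 sqr_ge0.
have : u = 0 by rewrite -(mulmxK S_unit u) -/v v0 mul0mx.
by move=> /rowP /(_ i); rewrite !mxE => ->.
Qed.

End quadratic_form.

Lemma qformZ (R : realType) n (S : 'M[R]_n) c (t : 'I_n -> R) :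
  qform S (fun i => c * t i) = c ^+ 2 * qform S t.
Proof.
rewrite /qform mulr_sumr; apply: eq_bigr => i _.
by rewrite mulr_sumr; apply: eq_bigr => j _; ring.
Qed.

Lemma qform_delta (R : realType) n (S : 'M[R]_n) i :
  qform S (fun j => (j == i)%:R) = S i i.
Proof.
rewrite /qform (bigD1 i)//= (bigD1 i)//= eqxx mul1r mulr1 !big1 ?addr0//.
  by move=> j ji; rewrite (negbTE ji) big1// => k _; rewrite !mul0r.
by move=> j ji; rewrite (negbTE ji) mulr0.
Qed.

(** * Existence of a maximizer of the ratio *)

Section diversification_ratio.
Context {R : realType} (n : nat) (S : 'M[R]_n).
Hypothesis S_gt0 : forall (t : 'I_n -> R) i, t i != 0 -> 0 < qform S t.

Lemma simplex_qform_gt0 w : simplex w -> 0 < qform S w.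
Proof.
move=> [w0 w1]; have [i wi] : exists i, w i != 0.
  apply/existsP; rewrite -negb_forall; apply/negP => /forallP w00.
  by move: w1; rewrite big1 => [/eqP|i _]; [rewrite eq_sym oner_eq0|exact/eqP].
exact: S_gt0 wi.
Qed.

Lemma simplex_delta i : simplex (fun j : 'I_n => (j == i)%:R : R).
Proof.
split=> [j|]; first by rewrite ler0n.
by rewrite (bigD1 i)//= eqxx big1 ?addr0// => j /negbTE ->.
Qed.

Lemma sum_continuous (V : topologicalType) (F : 'I_n -> V -> R) :
  (forall i, continuous (F i)) -> continuous (fun x => \sum_i F i x).
Proof.
move=> cF x; apply: cvg_big => [|i _]; [exact: add_continuous|exact: cF].
Qed.

(** The simplex is closed and lies in the compact cube [0, 1]^n, as no nonnegative coordinate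
    exceeds the total 1. *)
Lemma simplex_compact :
  compact [set u : 'rV[R]_n | simplex (u ord0)].
Proof.
have cs : continuous (fun u : 'rV[R]_n => \sum_i u ord0 i).
  by apply: sum_continuous => i; exact: coord_continuous.
apply: (@subclosed_compact _ _
  [set u : 'rV[R]_n | forall i, `[0, 1]%classic (u ord0 i)]).
- rewrite (_ : [set _ | _] =
     (\bigcap_i ((fun u : 'rV[R]_n => u ord0 i) @^-1` [set x | 0 <= x]))
     `&` (fun u : 'rV[R]_n => \sum_i u ord0 i) @^-1` [set 1]).
    apply: closedI.
      apply: closed_bigI => i _; apply: closed_comp => [u _|].
        exact: coord_continuous.
      exact: closed_ge.
    apply: closed_comp => [u _|]; last exact: closed_eq.
    exact: cs.
  by apply/seteqP; split => u [u0 u1]; split => // i; have := u0 i => //; exact.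
- exact: (@rV_compact R n (fun=> `[0, 1]%classic) (fun=> @segment_compact R 0 1)).
- move=> u [u0 u1] i /=; rewrite in_itv /= u0 /= -u1 (bigD1 i)//= lerDl.
  by apply: sumr_ge0.
Qed.

Lemma div_ratio_continuous (u : 'rV[R]_n) : 0 < qform S (u ord0) ->
  {for u, continuous (fun u : 'rV[R]_n => div_ratio S (u ord0))}.
Proof.
have ci i : continuous (fun u : 'rV[R]_n => u ord0 i) by exact: coord_continuous.
have cM (f g : 'rV[R]_n -> R) : continuous f -> continuous g ->
    continuous (fun u => f u * g u).
  by move=> cf cg x; exact: (continuousM (cf x) (cg x)).
have cn : continuous (fun u : 'rV[R]_n => \sum_i u ord0 i * Num.sqrt (S i i)).
  by apply: sum_continuous => i; apply: cM; [exact: ci|exact: cst_continuous].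
have cq : continuous (fun u : 'rV[R]_n => qform S (u ord0)).
  apply: sum_continuous => i; apply: sum_continuous => j.
  apply: (cM _ _); last exact: ci.
  by apply: cM; [exact: ci|exact: cst_continuous].
move=> q0; apply: continuousM; first exact: cn.
apply: continuousV; first by rewrite /= gt_eqF// sqrtr_gt0.
by apply: continuous_comp; [exact: cq|exact: sqrt_continuous].
Qed.

(** Extreme value theorem: the ratio is continuous on the simplex because the quadratic form is
    positive there, and [0 < n] provides a vertex. *)
Lemma div_ratio_max : (0 < n)%N ->
  exists w : 'I_n -> R, simplex w /\
     forall v, simplex v -> div_ratio S v <= div_ratio S w.
Proof.
move=> n0.
have rowK (v : 'I_n -> R) : (\row_j v j) ord0 = v.
  by apply/funext => j; rewrite mxE.
have [||u us umax] :=
  @EVT_max_rV R n (fun u => div_ratio S (u ord0)) _ _ simplex_compact.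
- exists (\row_j (j == Ordinal n0)%:R); rewrite /= rowK; exact: simplex_delta.
- apply: continuous_in_subspaceT => u; rewrite inE /= => us.
  by apply: div_ratio_continuous; exact: simplex_qform_gt0.
exists (u ord0); split; first by move: us; rewrite inE.
by move=> v vs; have := umax (\row_j v j); rewrite rowK; apply; rewrite inE /= rowK.
Qed.

End diversification_ratio.

(** * Elliptical laws and the diversification quotient *)

Section elliptical_law.
Context d (T : measurableType d) (R : realType) (P : probability T R).
Context (n : nat) (X : 'I_n -> T -> R) (mu : 'I_n -> R) (S : 'M[R]_n).
Variable tau : R -> R.
Hypothesis ellX : elliptical P X mu S tau.

Definition combo (t : 'I_n -> R) : T -> R := fun w => \sum_i t i * X i w.

Definition location (t : 'I_n -> R) : R := \sum_i t i * mu i.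

Definition scale (t : 'I_n -> R) : R := Num.sqrt (qform S t).

Definition standardized (t : 'I_n -> R) : T -> R :=
  fun w => (combo t w - location t) / scale t.

Lemma measurable_combo t : measurable_fun setT (combo t).
Proof.
have [mX _ _ _ _] := ellX; apply: measurable_sum => i.
exact: measurable_funM.
Qed.

Lemma measurable_standardized t : measurable_fun setT (standardized t).
Proof.
by apply: measurable_funM => //; apply: measurable_funB => //; exact: measurable_combo.
Qed.

(** The hypothesis on [X] is used along [s / scale t] times [t], where the quadratic form is
    [s ^+ 2]. Subtracting the location multiplies the characteristic function by exp(-i [th]), which
    cancels its phase; the two cases are the real and imaginary parts. *)
Lemma standardized_charfun t s : 0 < qform S t ->
  (\int[P]_w (cos (s * standardized t w))%:E = (tau (s ^+ 2))%:E)%E /\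
  (\int[P]_w (sin (s * standardized t w))%:E = 0)%E.
Proof.
move=> q0; have [_ _ _ _ /(_ (fun i => s / scale t * t i))[]] := ellX.
have sc0 : scale t != 0 by rewrite gt_eqF// sqrtr_gt0.
have -> : qform S (fun i => s / scale t * t i) = s ^+ 2.
  by rewrite qformZ exprMn exprVn sqr_sqrtr ?ltW// divfK// gt_eqF.
have comboZ w : \sum_i s / scale t * t i * X i w = s / scale t * combo t w.
  by rewrite mulr_sumr; apply: eq_bigr => i _; rewrite mulrA.
have -> : \sum_i s / scale t * t i * mu i = s / scale t * location t.
  by rewrite mulr_sumr; apply: eq_bigr => i _; rewrite mulrA.
under eq_integral do rewrite comboZ.
move=> cosE; under eq_integral do rewrite comboZ.
move=> sinE; set th := s / scale t * location t in cosE sinE.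
have mc : measurable_fun setT (fun w => s / scale t * combo t w).
  by apply: measurable_funM => //; exact: measurable_combo.
have Ic : P.-integrable setT (fun w => (cos (s / scale t * combo t w))%:E).
  exact: (bounded_comp_integrable P mc measurable_cos (@cos_max R)).
have Is : P.-integrable setT (fun w => (sin (s / scale t * combo t w))%:E).
  exact: (bounded_comp_integrable P mc measurable_sin (@sin_max R)).
have stdE w : s * standardized t w = s / scale t * combo t w - th.
  by rewrite /th /standardized; field.
have lin c c' : (\int[P]_w (c * cos (s / scale t * combo t w) +
      c' * sin (s / scale t * combo t w))%:E =
    (c * (cos th * tau (s ^+ 2)) + c' * (sin th * tau (s ^+ 2)))%:E)%E.
  under eq_integral do rewrite EFinD !EFinM.
  rewrite integralD//; [|exact: integrableZl|exact: integrableZl].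
  by rewrite !integralZl// cosE sinE.
split.
  transitivity (\int[P]_w (cos th * cos (s / scale t * combo t w) +
      sin th * sin (s / scale t * combo t w))%:E)%E.
    by apply: eq_integral => w _; rewrite stdE cosB; congr EFin; ring.
  by rewrite lin !mulrA -mulrDl -!expr2 cos2Dsin2 mul1r.
transitivity (\int[P]_w (- sin th * cos (s / scale t * combo t w) +
    cos th * sin (s / scale t * combo t w))%:E)%E.
  by apply: eq_integral => w _; rewrite stdE sinB; congr EFin; ring.
by rewrite lin; congr EFin; ring.
Qed.

Lemma standardized_cdf t u x : 0 < qform S t -> 0 < qform S u ->
  Defs.cdf P (standardized t) x = Defs.cdf P (standardized u) x.
Proof.
move=> t0 u0; congr fine; apply: cos_sin_mean_inj => [||s|s].
- exact: measurable_standardized.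
- exact: measurable_standardized.
- by rewrite /same_mean (standardized_charfun s t0).1 (standardized_charfun s u0).1.
- by rewrite /same_mean (standardized_charfun s t0).2 (standardized_charfun s u0).2.
Qed.

(** The sine means vanish and the cosine is even, so the variable and its opposite share their
    characteristic function. *)
Lemma standardized_sym t x : 0 < qform S t ->
  Defs.cdf P (\- standardized t) x = Defs.cdf P (standardized t) x.
Proof.
move=> t0; have mN := measurable_funN (measurable_standardized t).
congr fine; apply: cos_sin_mean_inj => [||s|s] //.
- exact: measurable_standardized.
- rewrite /same_mean; apply: eq_integral => w _.
  by rewrite mulrN cosN.
- rewrite /same_mean (standardized_charfun s t0).2.
  under eq_integral do rewrite /= mulrN -mulNr.
  exact: (standardized_charfun (- s) t0).2.
Qed.

(** The reference direction [u] is independent of [t]: one standardized variable thus represents all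
    portfolios in law. *)
Lemma combo_cdf t u x : 0 < qform S t -> 0 < qform S u ->
  Defs.cdf P (combo t) x =
  Defs.cdf P (standardized u) ((x - location t) / scale t).
Proof.
move=> t0 u0; rewrite -(standardized_cdf _ t0 u0) /Defs.cdf; congr (fine (P _)).
have sc0 : 0 < scale t by rewrite sqrtr_gt0.
by apply/seteqP; split => w /=; rewrite /standardized ler_pM2r ?invr_gt0// lerD2r.
Qed.

(** Makes the moment assumption on E_1(0, 1, tau) applicable to the standardized variable. *)
Lemma standardized_elliptical t : 0 < qform S t ->
  elliptical P (fun _ : 'I_1 => standardized t) (fun _ => 0) 1 tau.
Proof.
move=> t0; have q1 (s : 'I_1 -> R) : qform 1 s = s ord0 ^+ 2.
  by rewrite /qform !big_ord1 mxE mulr1.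
split.
- by move=> _; exact: measurable_standardized.
- exact: trmx1.
- by move=> s; rewrite q1 sqr_ge0.
- exact: oner_neq0.
- move=> s; have [cE sE] := standardized_charfun (s ord0) t0.
  rewrite q1 !big_ord1 mulr0 cos0 sin0 mul1r mul0r.
  by split; [rewrite -cE|rewrite -[RHS]sE];
    apply: eq_integral => w _; rewrite big_ord1.
Qed.

End elliptical_law.

(** * Monotonicity of the diversification quotient in the ratio *)

Section DQ_elliptical.
Context d (T : measurableType d) (R : realType) (n : nat).
Context (X : 'I_n -> T -> R) (mu : 'I_n -> R) (S : 'M[R]_n).
(** [f b] stands for rho_b of the reference variable, so that VaR and ES are treated together. *)
Variables (rho : R -> (T -> R) -> R) (f : R -> R) (a : R).
Hypothesis S_gt0 : forall t i, t i != 0 -> 0 < qform S t.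
Hypothesis rho_combo : forall t b, 0 < qform S t -> 0 < b < 1 ->
  rho b (combo X t) = location mu t + scale S t * f b.
Hypothesis rho0 : forall b, 0 < b < 1 -> rho b (fun=> 0) = 0.
Hypotheses (a01 : 0 < a < 1) (fa_ge0 : 0 <= f a).

(** The component is the combination along [w i] times the i-th basis vector, of scale
    [w i * Num.sqrt (S i i)]. A null weight has null scale, which [rho_combo] excludes, whence
    [rho0]. *)
Lemma rho_wprod w i : 0 <= w i ->
  rho a (wprod w X i) = w i * mu i + w i * Num.sqrt (S i i) * f a.
Proof.
move=> wi0; have [wi|wi] := eqVneq (w i) 0.
  rewrite wi !mul0r addr0 (_ : wprod w X i = fun=> 0) ?rho0//.
  by apply/funext => x; rewrite /wprod wi mul0r.
pose t j : R := w i * (j == i)%:R.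
have sum_t (F : 'I_n -> R) : \sum_j t j * F j = w i * F i.
  rewrite (bigD1 i)//= /t eqxx mulr1 big1 ?addr0// => j /negbTE ->.
  by rewrite mulr0 mul0r.
have -> : wprod w X i = combo X t by apply/funext => x; rewrite /combo sum_t.
rewrite rho_combo//; last by apply: (S_gt0 (i := i)); rewrite /t eqxx mulr1.
rewrite /location sum_t /scale qformZ qform_delta sqrtrM ?sqr_ge0//.
by rewrite sqrtr_sqr ger0_norm.
Qed.

(** The locations add up to [location mu w] on both sides and cancel; dividing by [scale S w > 0]
    leaves the ratio. *)
Lemma DQ_setE w : simplex w ->
  [set b | 0 < b < 1 /\
     rho b (fun x => \sum_i wprod w X i x) <= \sum_i rho a (wprod w X i)] =
  [set b | 0 < b < 1 /\ f b <= div_ratio S w * f a].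
Proof.
move=> ws; have [w0 w1] := ws.
have q0 : 0 < qform S w by exact: simplex_qform_gt0.
have -> : \sum_i rho a (wprod w X i) =
    location mu w + (\sum_i w i * Num.sqrt (S i i)) * f a.
  rewrite mulr_suml -big_split; apply: eq_bigr => i _; exact: rho_wprod.
have sc0 : 0 < scale S w by rewrite sqrtr_gt0.
have rb b : 0 < b < 1 -> rho b (fun x => \sum_i wprod w X i x) =
    location mu w + scale S w * f b by move=> b01; rewrite -rho_combo.
apply/seteqP; split => b [b01].
  rewrite rb// lerD2l => fb; split => //.
  by rewrite /div_ratio mulrAC ler_pdivlMr// mulrC.
move=> fb; split => //; rewrite rb// lerD2l.
by move: fb; rewrite /div_ratio mulrAC ler_pdivlMr// mulrC.
Qed.

(** As [f a >= 0], a larger ratio enlarges the set and so lowers its infimum. *)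
Lemma DQ_div_ratio_le v w : simplex v -> simplex w ->
  div_ratio S v <= div_ratio S w -> DQ rho a (wprod w X) <= DQ rho a (wprod v X).
Proof.
move=> vs ws vw; have /andP[a0 _] := a01.
rewrite /DQ !DQ_setE// ler_pM2r ?invr_gt0//.
set A := [set b | _ /\ f b <= div_ratio S v * _].
set B := [set b | _ /\ f b <= div_ratio S w * _].
have AB : A `<=` B.
  by move=> b [b01 fb]; split => //; rewrite (le_trans fb)// ler_wpM2r.
have infB b : B b -> inf B <= b.
  move=> Bb; apply: inf_lbound => //.
  by exists 0 => c [/andP[/ltW]].
(* An empty [B] forces [A] to be empty, and both values are 1. If only [A] is empty, its default 1
   exceeds the elements of [B], hence also [inf B]. *)
case: (pselect (B = set0)) => [B0|BN0] /=.
  by case: (pselect (A = set0)) => //= /eqP/set0P[b /AB]; rewrite B0.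
have /eqP/set0P[b Bb] := BN0.
case: (pselect (A = set0)) => [_|AN0] /=.
  by rewrite (le_trans (infB _ Bb))//; case: Bb => /andP[_ /ltW].
have /eqP/set0P A0 := AN0.
by apply: lb_le_inf => // c /AB; exact: infB.
Qed.

End DQ_elliptical.

Theorem theorem3 (d : measure_display) (T : measurableType d) (R : realType)
    (P : probability T R) (n : nat) (X : 'I_n -> T -> R) (mu : 'I_n -> R)
    (S : 'M[R]_n) (tau : R -> R) (a : R) :
  atomless P -> elliptical P X mu S tau -> S \in unitmx ->
  0 < a < 1 / 2 ->
  (exists w : 'I_n -> R, simplex w /\
     forall v, simplex v -> div_ratio S v <= div_ratio S w) /\
  (forall ws : 'I_n -> R, simplex ws ->
     (forall v, simplex v -> div_ratio S v <= div_ratio S ws) ->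
     (forall v, simplex v ->
        DQ (VaR P) a (wprod ws X) <= DQ (VaR P) a (wprod v X)) /\
     ((forall Y : T -> R,
         elliptical P (fun _ : 'I_1 => Y) (fun _ => 0) 1 tau ->
         P.-integrable setT (fun w => (`|Y w|)%:E)) ->
      forall v, simplex v ->
        DQ (ES P) a (wprod ws X) <= DQ (ES P) a (wprod v X))).
Proof.
move=> _ ellX S_unit a12.
have [_ S_sym S_psd SN0 _] := ellX.
have S_gt0 := qform_def S_sym S_psd S_unit.
(* A 0 by 0 matrix is zero, contrary to [S != 0]. *)
have n0 : (0 < n)%N.
  case: n S SN0 {S_gt0 S_sym S_psd S_unit X mu ellX} => // S0.
  by rewrite [S0]thinmx0 eqxx.
split; first exact: div_ratio_max.
move=> u us umax; have u0 : 0 < qform S u by exact: simplex_qform_gt0.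
(* Every direction with positive quadratic form gives the same law; the maximizer is taken as
   reference. *)
pose Y := standardized X mu S u.
have mY : measurable_fun setT Y by exact: (measurable_standardized ellX).
have symY x : Defs.cdf P (\- Y) x = Defs.cdf P Y x.
  exact: (standardized_sym ellX).
have cdfE t x : 0 < qform S t ->
    Defs.cdf P (combo X t) x = Defs.cdf P Y ((x - location mu t) / scale S t).
  by move=> t0; exact: (combo_cdf ellX).
have a01 : 0 < a < 1 by lra.
split=> [v vs|intY v vs].
  apply: (@DQ_div_ratio_le _ _ _ _ X mu S (VaR P) (fun b => VaR P b Y)) => //.
  - move=> t b t0 b01; apply: VaR_affine => //.
    + exact: (measurable_combo ellX).
    + by rewrite sqrtr_gt0.
    + by move=> x; exact: cdfE.
  - by move=> b; exact: VaR0.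
  - exact: VaR_sym_ge0.
  - exact: umax.
have iY : P.-integrable setT (EFin \o Y).
  have := intY _ (standardized_elliptical ellX u0).
  apply: le_integrable => //; first exact/measurable_EFinP.
  by move=> w _; rewrite /= lee_fin normr_id.
apply: (@DQ_div_ratio_le _ _ _ _ X mu S (ES P) (fun b => ES P b Y)) => //.
- move=> t b t0 b01; apply: ES_affine => //.
  + exact: (measurable_combo ellX).
  + by rewrite sqrtr_gt0.
  + by move=> x; exact: cdfE.
- by move=> b; exact: ES0.
- exact: ES_sym_ge0.
- exact: umax.
Qed.
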